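(* Let $g_1,\dots,g_s\in\mathbb{R}[x_1,\dots,x_n]$ and let $I\subset\mathbb{R}[x_1,\dots,x_n]$ be an ideal. If there exists $w\in(\mathbb{R}_{>0})^n$ such that $\operatorname{in}_w(I)$ is real radical and $\operatorname{in}_w(g_1),\dots,\operatorname{in}_w(g_s)$ is a quadratic module basis with respect to $\operatorname{in}_w(I)$, then the quadratic module $QM(g_1,\dots,g_s;I)$ is stable.
   Context: Initial forms: for $w\in\mathbb{R}^n$ and a nonzero polynomial $f=\sum_a f_a x^a$, $\deg_w(f)=\max\{w^Ta : f_a\ne0\}$ and $\operatorname{in}_w(f)=\sum_{a:\,w^Ta=\deg_w(f)}f_a x^a$; $\operatorname{in}_w(0)=0$. For an ideal $I$, $\operatorname{in}_w(I)=\langle \operatorname{in}_w(f): f\in I\rangle$. Real radical: an ideal $J\subset\mathbb{R}[x_1,\dots,x_n]$ is real radical if $J=\sqrt[\mathbb{R}]{J}$, where $\sqrt[\mathbb{R}]{J}=\{f : -f^{2m}\in\sum\mathbb{R}[x_1,\dots,x_n]^2+J\text{ for some integer } m\geq 1\}$; equivalently $\sqrt[\mathbb{R}]{J}$ is the set of all polynomials vanishing on the real zero set of $J$. Quadratic module basis: polynomials $p_1,\dots,p_s$ form a quadratic module basis (QM-basis) with respect to an ideal $J$ if for all finite families of polynomials $y_{ij}\in\mathbb{R}[x_1,\dots,x_n]$ ($0\le i\le s$), $\sum_j y_{0j}^2+\sum_{i\ge1,\,j}p_i y_{ij}^2\in J$ implies $y_{ij}\in J$ for all $i,j$. Quadratic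 modules: $QM(g_1,\dots,g_s)=\{\sigma_0+\sum_{i=1}^s g_i\sigma_i:\sigma_i\in\sum\mathbb{R}[x_1,\dots,x_n]^2\}$, where $\sum\mathbb{R}[x_1,\dots,x_n]^2$ is the set of finite sums of squares of polynomials. If $I=\langle h_1,\dots,h_t\rangle$, then $QM(g_1,\dots,g_s;I)$ denotes $QM(g_1,\dots,g_s,h_1,-h_1,\dots,h_t,-h_t)$, which equals $QM(g_1,\dots,g_s)+I$. Stability: a quadratic module $P=QM(p_1,\dots,p_r)\subset\mathbb{R}[x_1,\dots,x_n]$ is stable if there exists a function $l:\mathbb{N}\to\mathbb{N}$ such that for every (nonzero) $f\in P$ there are $\sigma_0,\dots,\sigma_r\in\sum\mathbb{R}[x_1,\dots,x_n]^2$ with $f=\sum_{i=0}^r\sigma_ip_i$, where $p_0=1$, and $\deg(\sigma_ip_i)\le l(\deg(f))$ for each $i$. (For $QM(g_1,\dots,g_s;I)$ the generators are $g_1,\dots,g_s,\pm h_1,\dots,\pm h_t$ with $h_1,\dots,h_t$ any finite generating set of $I$; stability does not depend on the choice of finite generating set.) *)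

(* Defs.v *)
From mathcomp Require Import all_boot all_order all_algebra.
From mathcomp Require Import reals.
From mathcomp Require Import mpoly.

Set Implicit Arguments.
Unset Strict Implicit.
Unset Printing Implicit Defensive.

Import Order.TTheory GRing.Theory Num.Theory.
Local Open Scope ring_scope.

Section Defs.
Variables (R : realType) (n : nat).
Local Notation P := {mpoly R[n]}.

(* Unlike [idealr_closed], this allows the unit ideal. *)
Definition is_ideal (J : P -> Prop) : Prop :=
  [/\ J 0, (forall p q, J p -> J q -> J (p + q))
    & (forall a p, J p -> J (a * p))].

Definition ideal_gen (S : P -> Prop) (f : P) : Prop :=
  exists2 c : seq (P * P),
    (forall u, u \in c -> S u.2) & f = \sum_(u <- c) u.1 * u.2.

Definition weight (w : 'I_n -> R) (a : 'X_{1..n}) : R :=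
  \sum_(i < n) w i * (a i)%:R.

(* For [f != 0] the monomial [mlead f] lies in [msupp f], so starting the
   maximum from its weight does not change it; [wdeg w 0] is irrelevant. *)
Definition wdeg (w : 'I_n -> R) (f : P) : R :=
  \big[Num.max/weight w (mlead f)]_(a <- msupp f) weight w a.

Definition init_form (w : 'I_n -> R) (f : P) : P :=
  \sum_(a <- msupp f | weight w a == wdeg w f) f@_a *: 'X_[a].

Definition init_ideal (w : 'I_n -> R) (J : P -> Prop) : P -> Prop :=
  ideal_gen (fun q => exists2 f, J f & q = init_form w f).

Definition sos (f : P) : Prop := exists ys : seq P, f = \sum_(y <- ys) y ^+ 2.

Definition real_rad (J : P -> Prop) (f : P) : Prop :=
  exists m : nat, (1 <= m)%N /\
    exists s q : P, [/\ sos s, J q & - f ^+ (2 * m)%N = s + q].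

Definition is_real_radical (J : P -> Prop) : Prop :=
  forall f, J f <-> real_rad J f.

Definition qm_basis (s : nat) (p : 'I_s -> P) (J : P -> Prop) : Prop :=
  forall (y0 : seq P) (y : 'I_s -> seq P),
    J (\sum_(z <- y0) z ^+ 2 + \sum_(i < s) \sum_(z <- y i) p i * z ^+ 2) ->
    (forall z, z \in y0 -> J z) /\ (forall i z, z \in y i -> J z).

(* [sigma] represents [f] over the generators [p]; the index 0 is the
   generator 1, the index [i.+1] is the [i]-th entry of [p]. *)
Definition qm_repr (p : seq P) (sigma : 'I_(size p).+1 -> P) (f : P) : Prop :=
  (forall i, sos (sigma i)) /\
  f = \sum_(i < (size p).+1) sigma i * (1 :: p)`_i.

Definition QM (p : seq P) (f : P) : Prop := exists sigma, @qm_repr p sigma f.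

(* [msize] is the total degree plus one, and 0 for the zero polynomial. *)
Definition tdeg (f : P) : nat := (msize f).-1.

Definition qm_stable (p : seq P) : Prop :=
  exists l : nat -> nat, forall f, f != 0 -> QM p f ->
    exists2 sigma, @qm_repr p sigma f &
      forall i, (tdeg (sigma i * (1 :: p)`_i)%R <= l (tdeg f))%N.

Definition pm_seq (h : seq P) : seq P := flatten [seq [:: q; - q] | q <- h].

(* Stability of QM(g; I), required for every finite generating set of [I];
   one exists by Hilbert's basis theorem. *)
Definition qm_mod_stable (s : nat) (g : 'I_s -> P) (I : P -> Prop) : Prop :=
  forall h : seq P, (forall f, I f <-> ideal_gen (fun q => q \in h) f) ->
    qm_stable (codom g ++ pm_seq h).

End Defs.

(* Main.v *)
Require Import Defs.
From HB Require Import structures.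
From mathcomp Require Import all_boot all_order all_algebra.
From mathcomp Require Import reals.
From mathcomp Require Import mpoly.
From mathcomp Require boolp.
From mathcomp Require Import ring lra zify.

Set Implicit Arguments.
Unset Strict Implicit.
Unset Printing Implicit Defensive.

Import Order.TTheory GRing.Theory Num.Theory.
Local Open Scope ring_scope.

(** Every homogeneous element of in_w(I) is the initial form of an element of I,
    so, the weights being well-ordered, each y can be changed modulo I until it
    is 0 or in_w(y) lies outside in_w(I). In a representation
    f = sum g_i y_ij^2 + r with reduced y_ij and r in I, a top weight above
    deg_w(f) would give sum in_w(g_i) in_w(y_ij)^2 in in_w(I), contradicting the
    QM-basis property. Hence all terms, and r, have weight at most deg_w(f), and
    positivity of w converts this into a bound on total degrees. Finally r lies in
    a finite-dimensional space of elements of I of bounded degree, whose members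
    have representations over the generators of I of uniformly bounded degree. *)

Lemma bigmax_id_or_mem (disp : Order.disp_t) (T : orderType disp) (A : eqType)
    (r : seq A) (x : T) (F : A -> T) :
  \big[Order.max/x]_(a <- r) F a = x \/
  exists2 a, a \in r & \big[Order.max/x]_(a <- r) F a = F a.
Proof.
elim: r => [|a r IH]; first by left; rewrite big_nil.
rewrite big_cons; case: leP => _.
  by case: IH => [->|[b br ->]]; [left | right; exists b; rewrite // inE br orbT].
by right; exists a; rewrite // inE eqxx.
Qed.

(** * Homogeneous components and the filtration by weight *)

Section WeightParts.
Variables (R : realType) (n : nat) (w : 'I_n -> R).
Local Notation P := {mpoly R[n]}.
Implicit Types (p q f : P) (a b : 'X_{1..n}) (c d : R).

(** Unlike [init_form], this is additive in [p], because the weight is fixed in advance.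
    Cancellation of top terms thus becomes linear algebra. *)
Definition wpart c p : P := \sum_(a <- msupp p | weight w a == c) p@_a *: 'X_[a].

(** Zero satisfies this bound for every [c], so sums that cancel need no case distinction and the
    conventional value [wdeg w 0] never interferes. *)
Definition wle c p : Prop := forall a, a \in msupp p -> weight w a <= c.

Lemma weightD a b : weight w (a + b)%MM = weight w a + weight w b.
Proof.
by rewrite -big_split; apply: eq_bigr => i _; rewrite mnmDE natrD mulrDr.
Qed.

Lemma mcoeff_wpart c p a : (wpart c p)@_a = if weight w a == c then p@_a else 0.
Proof.
rewrite raddf_sum /=.
have [/[dup] a_p|a_p] := boolP (a \in msupp p); last first.
  rewrite big_seq_cond big1 => [|b /andP[bp _]].
    by rewrite memN_msupp_eq0 // if_same.
  rewrite mcoeffZ mcoeffX; case: eqP => [eq_ba|]; last by rewrite mulr0.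
  by rewrite eq_ba (negPf a_p) in bp.
rewrite big_mkcond => /(bigD1_seq a) /= ->; rewrite ?msupp_uniq //.
rewrite big1 /= ?addr0 => [|b /negPf ne_ba]; last first.
  by rewrite mcoeffZ mcoeffX ne_ba mulr0 if_same.
by case: eqP => // _; rewrite mcoeffZ mcoeffX eqxx mulr1.
Qed.

Fact wpart_is_zmod_morphism c : zmod_morphism (wpart c).
Proof.
move=> p q; apply/mpolyP => a; rewrite mcoeffB !mcoeff_wpart mcoeffB.
by case: eqP => // _; rewrite subrr.
Qed.

HB.instance Definition _ c :=
  GRing.isZmodMorphism.Build P P (wpart c) (wpart_is_zmod_morphism c).

Lemma wleP c p : wle c p <-> forall a, c < weight w a -> p@_a = 0.
Proof.
split=> [le_p a|le_p a a_p].
  by rewrite ltNge => /negP lt_a; apply: memN_msupp_eq0; apply/negP => /le_p.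
by rewrite leNgt; apply: contraTN a_p => /le_p; rewrite mcoeff_msupp => ->; rewrite eqxx.
Qed.

Lemma wle0 c : wle c 0. Proof. by move=> a; rewrite msupp0. Qed.

Lemma wleD c p q : wle c p -> wle c q -> wle c (p + q).
Proof.
move=> /wleP le_p /wleP le_q; apply/wleP => a lt_a.
by rewrite mcoeffD le_p // le_q // addr0.
Qed.

Lemma wleN c p : wle c p -> wle c (- p).
Proof. by move=> le_p a; rewrite (perm_mem (msuppN p)); apply: le_p. Qed.

Lemma wle_sum (A : eqType) (r : seq A) (F : A -> P) c :
  (forall x, x \in r -> wle c (F x)) -> wle c (\sum_(x <- r) F x).
Proof.
move=> le_F; rewrite big_seq; apply: (big_ind (wle c)) => //; first exact: wle0.
exact: wleD.
Qed.

Lemma wle_trans c d p : wle c p -> c <= d -> wle d p.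
Proof. by move=> le_p le_cd a /le_p /le_trans; apply. Qed.

Lemma wleM c d p q : wle c p -> wle d q -> wle (c + d) (p * q).
Proof.
move=> /wleP le_p /wleP le_q; apply/wleP => a; rewrite mcoeffM => lt_a.
apply: big1 => k /eqP/(congr1 (weight w)); rewrite weightD => wa.
have [lt_k|le_k] := ltP c (weight w k.1); first by rewrite le_p // mul0r.
by rewrite le_q ?mulr0 //; lra.
Qed.

(** If two monomials of weights at most [c] and [d] have a product of weight [c + d], both bounds
    are attained; only the top components contribute. *)
Lemma wpartM c d p q : wle c p -> wle d q ->
  wpart (c + d) (p * q) = wpart c p * wpart d q.
Proof.
move=> /wleP le_p /wleP le_q; apply/mpolyP => a.
rewrite mcoeff_wpart !mcoeffM.
have [eq_w|ne_w] := eqP; last symmetry; [apply: eq_bigr|apply: big1];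
  move=> k /eqP/(congr1 (weight w)); rewrite weightD !mcoeff_wpart => wa.
  have [lt_k|gt_k|eq_k] := ltgtP (weight w k.1) c.
  - by rewrite (le_q k.2) ?mulr0 ?if_same ?mulr0 //; lra.
  - by rewrite le_p // !mul0r.
  - by have -> : weight w k.2 == d by apply/eqP; lra.
have [eq1|] := eqP; last by rewrite mul0r.
have [eq2|] := eqP; last by rewrite mulr0.
by case: ne_w; lra.
Qed.

(** Multiplication by a form homogeneous of weight [d] shifts every weight by [d]. *)
Lemma wpartMpart c d p q :
  wpart c (p * wpart d q) = wpart (c - d) p * wpart d q.
Proof.
apply/mpolyP => a; rewrite mcoeff_wpart !mcoeffM.
have [eq_w|ne_w] := eqP; last symmetry; [apply: eq_bigr|apply: big1];
  move=> k /eqP/(congr1 (weight w)); rewrite weightD !mcoeff_wpart => wa.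
  have [eq2|] := eqVneq (weight w k.2) d; last by rewrite !mulr0.
  have -> // : weight w k.1 == c - d.
  by apply/eqP; lra.
have [eq1|] := eqP; last by rewrite mul0r.
have [eq2|] := eqP; last by rewrite mulr0.
by case: ne_w; lra.
Qed.

Lemma wle_wpart c p : wle c (wpart c p).
Proof.
move=> a; rewrite mcoeff_msupp mcoeff_wpart.
by have [->//|_] := eqVneq (weight w a) c; rewrite eqxx.
Qed.

Lemma wpart_id c p : wpart c (wpart c p) = wpart c p.
Proof. by apply/mpolyP => a; rewrite !mcoeff_wpart; case: eqP. Qed.

Lemma wpart_lt c d p : wle c p -> c < d -> wpart d p = 0.
Proof.
move=> /wleP le_p lt_cd; apply/mpolyP => a; rewrite mcoeff_wpart mcoeff0.
by have [eq_a|//] := eqP; rewrite le_p // eq_a.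
Qed.

Lemma wle_wdeg p : wle (wdeg w p) p.
Proof. by move=> a a_p; apply: le_bigmax_seq. Qed.

Lemma wdeg_mem p : p != 0 -> exists2 a, a \in msupp p & wdeg w p = weight w a.
Proof.
move=> p0; rewrite /wdeg; case: (bigmax_id_or_mem (msupp p) (weight w (mlead p)) (weight w)) => //.
by move=> ->; exists (mlead p); rewrite ?mlead_supp.
Qed.

Lemma init_formE p : init_form w p = wpart (wdeg w p) p. Proof. by []. Qed.

Lemma init_form1 : init_form w 1 = 1.
Proof.
have wdeg1 : wdeg w 1 = 0.
  have [|a] := @wdeg_mem 1; first exact: oner_neq0.
  rewrite msupp1 inE => /eqP -> ->.
  by rewrite /weight big1 // => i _; rewrite mnm0E mulr0.
apply/mpolyP => a; rewrite init_formE mcoeff_wpart wdeg1 mcoeff1.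
case: (eqVneq a 0%MM) => [->|]; last by rewrite if_same.
by rewrite /weight big1 ?eqxx // => i _; rewrite mnm0E mulr0.
Qed.

Lemma wle_wdeg_le c p : p != 0 -> wle c p -> wdeg w p <= c.
Proof. by move=> /wdeg_mem[a a_p ->]; apply. Qed.

Lemma wdeg_lt c p : p != 0 -> wle c p -> wpart c p = 0 -> wdeg w p < c.
Proof.
move=> p0 le_p part0; rewrite lt_neqAle wle_wdeg_le // andbT.
have [a a_p ->] := wdeg_mem p0; apply/eqP => eq_c.
move/mpolyP/(_ a): part0; rewrite mcoeff_wpart eq_c eqxx mcoeff0 => pa0.
by rewrite mcoeff_msupp pa0 eqxx in a_p.
Qed.

End WeightParts.

Arguments wle_wdeg {R n} w p.
Arguments wle_wpart {R n} w c p.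

(** * Homogeneous components of the initial ideal *)

Section Ideals.
Variables (R : realType) (n : nat) (w : 'I_n -> R).
Local Notation P := {mpoly R[n]}.
Variables (I : P -> Prop) (hI : is_ideal I).

Lemma ideal0 : I 0. Proof. by case: hI. Qed.
Lemma idealD p q : I p -> I q -> I (p + q). Proof. by case: hI => _ + _; apply. Qed.
Lemma idealM a p : I p -> I (a * p). Proof. by case: hI => _ _; apply. Qed.
Lemma idealN p : I p -> I (- p). Proof. by rewrite -mulN1r; apply: idealM. Qed.
Lemma init_ideal0 : init_ideal w I 0.
Proof. by exists [::]; rewrite ?big_nil. Qed.

(** Either [c] is the weighted degree of [p] and the component is its initial form, or [c] lies
    above it and the component vanishes. *)
Lemma init_ideal_wpart c p : I p -> wle w c p -> init_ideal w I (wpart w c p).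
Proof.
move=> Ip le_p; have [->|p0] := eqVneq p 0; first by rewrite raddf0; apply: init_ideal0.
have := wle_wdeg_le p0 le_p; rewrite le_eqVlt => /predU1P[<-|lt_p].
  exists [:: (1, init_form w p)]; last by rewrite big_seq1 mul1r.
  by move=> u; rewrite inE => /eqP->; exists p.
by rewrite (wpart_lt (wle_wdeg w p)) //; apply: init_ideal0.
Qed.

(** In a combination of initial forms of elements [f] of [I], the weight-[c] component only sees the
    part of each coefficient of weight [c - wdeg w f]. Multiplying that part by [f] itself instead
    of its initial form gives an element of [I] with the same top component. *)
Lemma init_ideal_lift c q : init_ideal w I q ->
  exists u, [/\ I u, wle w c u & wpart w c u = wpart w c q].
Proof.
case=> r gen_r ->; elim: r gen_r => [|[a q'] r IH] gen_r.
  exists 0; split; [exact: ideal0 | exact: wle0 | by rewrite big_nil].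
have [u ur|u [Iu le_u eq_u]] := IH; first by apply: gen_r; rewrite inE ur orbT.
have [f If /= eq_q'] : exists2 f, I f & q' = init_form w f.
  by have := gen_r (a, q'); rewrite inE eqxx => /(_ isT).
exists (wpart w (c - wdeg w f) a * f + u); split.
- exact/idealD/Iu/idealM.
- apply: wleD le_u; rewrite -[c in wle _ c](subrK (wdeg w f)).
  by apply: wleM; [apply: wle_wpart | apply: wle_wdeg].
rewrite big_cons !raddfD /= eq_u eq_q' init_formE wpartMpart; congr (_ + _).
have := wpartM (wle_wpart w (c - wdeg w f) a) (wle_wdeg w f).
by rewrite subrK wpart_id => ->.
Qed.

End Ideals.

(** * Positive weights, reduction modulo the ideal, and the weight bound *)

Section Reduction.
Variables (R : realType) (n : nat) (w : 'I_n -> R) (w_gt0 : forall i, 0 < w i).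
Local Notation P := {mpoly R[n]}.

Lemma weight_ge_mdeg :
  exists C : nat, forall a : 'X_{1..n}, (mdeg a)%:R <= C%:R * weight w a.
Proof.
(* Each summand is a natural number above one inverse weight, so the sum dominates all inverse
   weights at once. *)
exists (\sum_i Num.bound (w i)^-1)%N => a.
rewrite mdegE natr_sum /weight mulr_sumr; apply: ler_sum => i _; rewrite mulrA.
rewrite -[leLHS]mul1r ler_wpM2r // -ler_pdivrMr // mul1r.
apply/(le_trans (ltW (archi_boundP _))); first by rewrite invr_ge0 ltW.
by rewrite ler_nat (bigD1 i) //= leq_addr.
Qed.

Lemma weight_le_mdeg :
  exists M : nat, forall a : 'X_{1..n}, weight w a <= M%:R * (mdeg a)%:R.
Proof.
exists (\sum_i Num.bound (w i))%N => a.
rewrite mdegE [X in _ <= _ * X]natr_sum mulr_sumr; apply: ler_sum => i _.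
rewrite ler_wpM2r //; apply/(le_trans (ltW (archi_boundP (ltW (w_gt0 i))))).
by rewrite ler_nat (bigD1 i) //= leq_addr.
Qed.

Lemma mdeg_bounded_finite (B : nat) :
  exists T : seq 'X_{1..n}, forall a, (mdeg a <= B)%N -> a \in T.
Proof.
exists [seq val b | b : 'X_{1..n < B.+1}] => a le_a.
by apply/mapP; exists (BMultinom (le_a : (mdeg a < B.+1)%N)); rewrite ?mem_enum.
Qed.

(** This finiteness stands in for well-ordering of the real weights that occur. *)
Lemma weight_bounded_finite c :
  exists T : seq 'X_{1..n}, forall a, weight w a <= c -> a \in T.
Proof.
have [C le_C] := weight_ge_mdeg.
have [T inT] := mdeg_bounded_finite (Num.bound (C%:R * `|c|)).
exists T => a le_a; apply: inT; rewrite -(ler_nat R).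
apply: le_trans (le_C a) _.
apply: le_trans (ltW (archi_boundP _)); last by rewrite mulr_ge0.
by rewrite ler_wpM2l // (le_trans le_a) // ler_norm.
Qed.

Variables (I : P -> Prop) (hI : is_ideal I).

(** As long as the initial form of [y] lies in the initial ideal, it can be cancelled by an element
    of [I]. The induction is on the length of a list containing all monomials of weight at most
    [wdeg w y]. *)
Lemma reduce_mod y : exists y', I (y - y') /\
  (y' = 0 \/ ~ init_ideal w I (init_form w y')).
Proof.
have [T] := weight_bounded_finite (wdeg w y).
have [N le_T] := ubnP (size T); elim: N y T le_T => // N IH y T le_T inT.
have [->|y0] := eqVneq y 0.
  by exists 0; rewrite subrr; split; [apply: ideal0 | left].
case: (boolp.EM (init_ideal w I (init_form w y))) => [Jy|]; last first.
  by exists y; rewrite subrr; split; [apply: ideal0 | right].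
have [u [Iu le_u]] := init_ideal_lift hI (wdeg w y) Jy.
rewrite init_formE wpart_id => eq_u.
have [a a_y eq_a] := wdeg_mem w y0.
have aT : a \in T by rewrite inT ?eq_a.
have [yu0|yu0] := eqVneq (y - u) 0.
  by exists 0; rewrite subr0 -[y](subrK u) yu0 add0r; split; [| left].
have lt_yu : wdeg w (y - u) < wdeg w y.
  apply: wdeg_lt => //; last by rewrite raddfB /= eq_u subrr.
  by apply: wleD; [apply: wle_wdeg | apply: wleN].
(* The monomial [a] attains the old weighted degree, hence is too heavy for [y - u] and can leave
   the list. *)
have [| b le_b | y' [Iy' redy']] := IH (y - u) (rem a T).
- by rewrite size_rem //; case: (T) aT le_T.
- apply: rem_mem; last by rewrite inT // (le_trans le_b) // ltW.
  by apply: contraTneq (le_lt_trans le_b lt_yu) => ->; rewrite eq_a ltxx.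
exists y'; split=> //.
by rewrite (_ : y - y' = (y - u - y') + u); [apply: idealD | ring].
Qed.

Variables (s : nat) (g : 'I_s -> P).
Local Notation G := (oapp g 1).

(* [None] is the index of the generator 1. *)
Lemma qm_basis_flat (p : 'I_s -> P) (J : P -> Prop) (L : seq (option 'I_s * P)) :
  qm_basis p J -> J (\sum_(u <- L) oapp p 1 u.1 * u.2 ^+ 2) ->
  forall u, u \in L -> J u.2.
Proof.
move=> basis JL.
pose Y o := [seq u.2 | u <- L & u.1 == o].
have [] := basis (Y None) (fun i => Y (Some i)).
  suff <- : \sum_(u <- L) oapp p 1 u.1 * u.2 ^+ 2 =
    \sum_(z <- Y None) z ^+ 2 + \sum_(i < s) \sum_(z <- Y (Some i)) p i * z ^+ 2 by [].
  have -> : \sum_(i < s) \sum_(z <- Y (Some i)) p i * z ^+ 2 =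
      \sum_(u <- L) \sum_(i < s | u.1 == Some i) p i * u.2 ^+ 2.
    rewrite (exchange_big_dep predT) //=; apply: eq_bigr => i _.
    by rewrite big_map big_filter.
  rewrite big_map big_filter [X in _ = X + _]big_mkcond -big_split; apply: eq_bigr => -[[i|] z] _ /=.
    by rewrite add0r (big_pred1 i).
  by rewrite big_pred0 ?addr0 ?mul1r.
move=> J0 Ji [[i|] z] uL /=; [apply: (Ji i) | apply: J0];
  by apply/mapP; eexists; first by rewrite mem_filter; apply/andP; split; last exact: uL.
Qed.

Hypothesis basis : qm_basis (fun i => init_form w (g i)) (init_ideal w I).

(* At the top weight D the squares could only cancel modulo the initial ideal,
   which the basis property forbids for reduced y. *)
Lemma reduced_wdeg_le (L : seq (option 'I_s * P)) f h :
  f = \sum_(u <- L) G u.1 * u.2 ^+ 2 + h -> I h ->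
  (forall u, u \in L -> ~ init_ideal w I (init_form w u.2)) ->
  forall u, u \in L -> wle w (wdeg w f) (G u.1 * u.2 ^+ 2).
Proof.
move=> eq_f Ih redL.
(* Adding the weighted degrees of the factors, rather than taking that of the product, avoids a
   separate case for a zero generator. *)
pose e (u : option 'I_s * P) := wdeg w (G u.1) + (wdeg w u.2 + wdeg w u.2).
have le_e u : wle w (e u) (G u.1 * u.2 ^+ 2).
  by rewrite expr2; apply/wleM/wleM; apply: wle_wdeg.
(* Starting from [wdeg w f] gives two cases: [D] is the desired bound, or some term [v] has
   [e v = D]. *)
pose D := \big[Order.max/wdeg w f]_(u <- L) e u.
have e_le_D u : u \in L -> e u <= D by move=> uL; apply: le_bigmax_seq.
have f_le_D : wdeg w f <= D by apply: bigmax_ge_id.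
suff eq_D : D = wdeg w f.
  by move=> u /e_le_D; rewrite eq_D; apply: wle_trans.
case: (bigmax_id_or_mem L (wdeg w f) e) => // -[v vL]; rewrite -/D => Dv.
move: f_le_D; rewrite le_eqVlt => /predU1P[//|lt_fD]; exfalso.
have le_sum : wle w D (\sum_(u <- L) G u.1 * u.2 ^+ 2).
  by apply: wle_sum => u uL; apply: wle_trans (le_e u) (e_le_D u uL).
have le_h : wle w D h.
  have -> : h = f - \sum_(u <- L) G u.1 * u.2 ^+ 2 by rewrite eq_f addrC addKr.
  apply: wleD; last exact: wleN.
  exact: wle_trans (wle_wdeg w f) (ltW lt_fD).
pose L' := [seq (u.1, init_form w u.2) | u <- L & e u == D].
(* Since [f] has no component of weight [D], the top components of the squares and of [h] cancel. *)
have topE : \sum_(u <- L') oapp (fun i => init_form w (g i)) 1 u.1 * u.2 ^+ 2 =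
    wpart w D (- h).
  have <- : wpart w D (\sum_(u <- L) G u.1 * u.2 ^+ 2) = wpart w D (- h).
    have := wpart_lt (wle_wdeg w f) lt_fD; rewrite {1}eq_f raddfD raddfN /=.
    by move/eqP; rewrite addr_eq0 => /eqP.
  rewrite raddf_sum big_map big_filter [RHS]big_seq big_mkcond big_seq /=.
  apply: eq_bigr => u uL; have := e_le_D u uL; rewrite le_eqVlt.
  case: eqP => [<- _|_ /= lt_e]; last by rewrite (wpart_lt (le_e u)).
  rewrite expr2 !wpartM; try by [apply: wle_wdeg | apply: wleM; apply: wle_wdeg].
  rewrite -expr2; congr (_ * _); case: (u.1) => [i|] //=.
  by rewrite -init_formE init_form1.
have := qm_basis_flat basis; move=> /(_ L').
rewrite topE => /(_ (init_ideal_wpart (idealN hI Ih) (wleN le_h))).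
move=> /(_ (v.1, init_form w v.2)) JL'.
apply: (redL v vL); apply: JL'; apply/mapP; exists v => //.
by rewrite mem_filter vL Dv eqxx.
Qed.

End Reduction.

Lemma mem_pm_seq (R : realType) (n : nat) (h : seq {mpoly R[n]}) q :
  (q \in pm_seq h) = has (fun r => (q == r) || (q == - r)) h.
Proof.
by elim: h => //= r h; rewrite /pm_seq /= !inE => <-; rewrite orbA.
Qed.

(** * Elements of the quadratic module as reduced sums modulo the ideal *)

Section Decomposition.
Variables (R : realType) (n s : nat) (g : 'I_s -> {mpoly R[n]}).
Local Notation P := {mpoly R[n]}.
Variables (I : P -> Prop) (hI : is_ideal I) (h : seq P).
Hypothesis Igen : forall f, I f <-> ideal_gen (fun q => q \in h) f.

(** Terms over the generators from [pm_seq h] lie in [I] and are absorbed in [r]; the other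
    multipliers are split into single squares. *)
Lemma QM_split f : QM (codom g ++ pm_seq h) f ->
  exists (L : seq (option 'I_s * P)) r,
    f = \sum_(u <- L) oapp g 1 u.1 * u.2 ^+ 2 + r /\ I r.
Proof.
move=> [sg [sos_sg ->]].
pose Q f := exists (L : seq (option 'I_s * P)) r,
    f = \sum_(u <- L) oapp g 1 u.1 * u.2 ^+ 2 + r /\ I r.
have Q_gen o t : sos t -> Q (t * oapp g 1 o).
  move=> [ys ->]; exists [seq (o, y) | y <- ys], 0; split; last exact: ideal0.
  by rewrite addr0 big_map mulr_suml; apply: eq_bigr => y _; rewrite mulrC.
apply: (big_ind Q).
- by exists [::], 0; rewrite big_nil addr0; split; last exact: ideal0.
- move=> _ _ [L1 [r1 [-> I1]]] [L2 [r2 [-> I2]]]; exists (L1 ++ L2), (r1 + r2).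
  by rewrite big_cat /= addrACA; split=> //; apply: idealD.
move=> i _; set q := _`_i.
have : q \in 1 :: codom g ++ pm_seq h by apply: mem_nth; rewrite /= ltn_ord.
rewrite inE mem_cat => /or3P[/eqP->|/codomP[k ->]|].
- exact: (Q_gen None).
- exact: (Q_gen (Some k)).
rewrite mem_pm_seq => /hasP[q' q'h eq_q].
have Iq' : I q'.
  apply/Igen; exists [:: (1, q')]; last by rewrite big_seq1 mul1r.
  by move=> u; rewrite inE => /eqP->.
exists [::], (sg i * q); rewrite big_nil add0r; split=> //; apply: idealM => //.
by case/orP: eq_q => /eqP-> //; apply: idealN.
Qed.

(** Replacing [y] by [y'] changes a term by a multiple of [(y - y') * (y + y')], which moves into
    [r]. Terms that reduce to zero are dropped. *)
Lemma QM_reduced (w : 'I_n -> R) f : (forall i, 0 < w i) ->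
  QM (codom g ++ pm_seq h) f ->
  exists (L : seq (option 'I_s * P)) r,
    [/\ f = \sum_(u <- L) oapp g 1 u.1 * u.2 ^+ 2 + r, I r
      & forall u, u \in L -> ~ init_ideal w I (init_form w u.2)].
Proof.
move=> w_gt0 /QM_split[L [r [-> Ir]]]; elim: L => [|[o y] L [L' [r' [eq_f Ir' redL']]]].
  by exists [::], r.
have [y' [Iy' redy']] := reduce_mod w_gt0 hI y.
have Ir'' : I (r' + oapp g 1 o * (y ^+ 2 - y' ^+ 2)).
  by apply: idealD => //; apply: idealM => //; rewrite subr_sqr mulrC; apply: idealM.
rewrite big_cons -addrA eq_f /=.
case: redy' => [y'0|redy'].
  exists L', (r' + oapp g 1 o * (y ^+ 2 - y' ^+ 2)); split=> //.
  by rewrite y'0; ring.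
exists ((o, y') :: L'), (r' + oapp g 1 o * (y ^+ 2 - y' ^+ 2)); split=> //.
  by rewrite big_cons /=; ring.
by move=> u; rewrite inE => /predU1P[->|/redL'].
Qed.

End Decomposition.

(** * Cones of elements with representations of bounded degree *)

Section BoundedRepresentations.
Variables (R : realType) (n : nat).
Local Notation P := {mpoly R[n]}.
Implicit Types (f q : P) (p : seq P) (N : nat).

Lemma tdeg_leP N f : (tdeg f <= N)%N <-> forall a, a \in msupp f -> (mdeg a <= N)%N.
Proof.
rewrite /tdeg -subn1 leq_subLR add1n; split=> [le_f a /msize_mdeg_lt lt_a|le_f].
  by rewrite -ltnS (leq_trans lt_a).
by rewrite msizeE big_seq; apply: (big_ind (fun m => m <= N.+1)%N) => // x y;
  rewrite geq_max => -> ->.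
Qed.

Lemma tdegD_le N f q : (tdeg f <= N -> tdeg q <= N -> tdeg (f + q) <= N)%N.
Proof.
move=> /tdeg_leP le_f /tdeg_leP le_q; apply/tdeg_leP => a /msuppD_le.
by rewrite mem_cat => /orP[/le_f|/le_q].
Qed.

Lemma sos0 : sos (0 : P). Proof. by exists [::]; rewrite big_nil. Qed.

Lemma sosD f q : sos f -> sos q -> sos (f + q).
Proof. by move=> [ys ->] [zs ->]; exists (ys ++ zs); rewrite big_cat. Qed.

Lemma sosX2 f : sos (f ^+ 2). Proof. by exists [:: f]; rewrite big_seq1. Qed.

Lemma sosZ (c : R) f : 0 <= c -> sos f -> sos (c *: f).
Proof.
move=> c_ge0 [ys ->]; exists [seq Num.sqrt c *: y | y <- ys].
rewrite big_map scaler_sumr; apply: eq_bigr => y _.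
by rewrite exprZn sqr_sqrtr.
Qed.

Definition qm_bounded p N f := exists2 sigma, @qm_repr R n p sigma f &
  forall i, (tdeg (sigma i * (1 :: p)`_i)%R <= N)%N.

Lemma qm_bounded_mono p N N' f : (N <= N')%N -> qm_bounded p N f -> qm_bounded p N' f.
Proof. by move=> leN [sg rep le_sg]; exists sg => // i; apply: leq_trans leN. Qed.

Lemma qm_bounded0 p N : qm_bounded p N 0.
Proof.
exists (fun=> 0) => [|i]; last by rewrite mul0r /tdeg msize0.
by split=> [_|]; [apply: sos0 | rewrite big1 // => i _; rewrite mul0r].
Qed.

Lemma qm_boundedD p N f q :
  qm_bounded p N f -> qm_bounded p N q -> qm_bounded p N (f + q).
Proof.
move=> [sg [sos_sg ->] le_sg] [tau [sos_tau ->] le_tau].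
exists (fun i => sg i + tau i) => [|i]; last by rewrite mulrDl tdegD_le.
split=> [i|]; first exact: sosD.
by rewrite -big_split; apply: eq_bigr => i _; rewrite mulrDl.
Qed.

Lemma qm_bounded_sum (A : eqType) (r : seq A) (F : A -> P) p N :
  (forall x, x \in r -> qm_bounded p N (F x)) -> qm_bounded p N (\sum_(x <- r) F x).
Proof.
move=> bF; rewrite big_seq; apply: (big_ind (qm_bounded p N)) => //.
  exact: qm_bounded0.
exact: qm_boundedD.
Qed.

Lemma qm_boundedZ p N (c : R) f : 0 <= c -> qm_bounded p N f -> qm_bounded p N (c *: f).
Proof.
move=> c_ge0 [sg [sos_sg ->] le_sg]; exists (fun i => c *: sg i) => [|i].
  split=> [i|]; first exact: sosZ.
  by rewrite scaler_sumr; apply: eq_bigr => i _; rewrite scalerAl.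
rewrite -scalerAl; apply: leq_trans (le_sg i).
by rewrite /tdeg -!subn1 leq_sub2r // msizeZ_le.
Qed.

Lemma qm_bounded_gen p N sg q :
  q \in 1 :: p -> sos sg -> (tdeg (sg * q) <= N)%N -> qm_bounded p N (sg * q).
Proof.
move=> qp sos_sg le_sg.
(* Generators may repeat; the whole term is placed at the first occurrence of [q]. *)
have lt_i : (index q (1%R :: p) < (size p).+1)%N.
  by rewrite -[(size p).+1]/(size (1 :: p)) index_mem.
pose i0 := Ordinal lt_i.
have nth_i0 : (1 :: p)`_i0 = q by apply: (nth_index 0 qp).
exists (fun i => if i == i0 then sg else 0) => [|i].
  split=> [i|]; first by case: ifP => // _; apply: sos0.
  rewrite (bigD1 i0) //= eqxx -[X in sg * X + _]/((1 :: p)`_i0) nth_i0.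
  by rewrite big1 ?addr0 // => i /negPf->; rewrite mul0r.
case: eqP => [->|_]; first by rewrite nth_i0.
by rewrite mul0r /tdeg msize0.
Qed.

(* [a * q = ((a + 1) / 2)^2 * q + ((a - 1) / 2)^2 * (- q)] *)
Lemma qm_bounded_pm p q a : q \in p -> - q \in p -> exists N, qm_bounded p N (a * q).
Proof.
move=> qp Nqp.
pose b := 2^-1 *: (a + 1); pose c := 2^-1 *: (a - 1).
exists (maxn (tdeg (b ^+ 2 * q)) (tdeg (c ^+ 2 * - q))).
have -> : a * q = b ^+ 2 * q + c ^+ 2 * - q.
  rewrite mulrN -mulrBl; congr (_ * _).
  rewrite /b /c !exprZn -scalerBr.
  have -> : (a + 1) ^+ 2 - (a - 1) ^+ 2 = 4%:R *: a by rewrite scaler_nat; ring.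
  by rewrite scalerA (_ : _ * _ = 1) ?scale1r //; field.
apply: qm_boundedD; apply: qm_bounded_gen;
  rewrite ?inE ?qp ?Nqp ?orbT ?leq_maxl ?leq_maxr //; exact: sosX2.
Qed.

(* Subspaces of polynomials supported in a fixed finite set are finite-dimensional:
   eliminating one monomial at a time, finitely many elements of K suffice. *)
Lemma uniform_bound_support (K : P -> Prop) (B : nat -> P -> Prop) :
  (forall f q, K f -> K q -> K (f + q)) -> (forall c f, K f -> K (c *: f)) ->
  (forall N f q, B N f -> B N q -> B N (f + q)) ->
  (forall N c f, B N f -> B N (c *: f)) ->
  (forall N, B N 0) -> (forall N N' f, (N <= N')%N -> B N f -> B N' f) ->
  (forall f, K f -> exists N, B N f) ->
  forall T : seq 'X_{1..n}, exists N, forall f, K f -> {subset msupp f <= T} -> B N f.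
Proof.
move=> KD KZ BD BZ B0 Bmono Bex; elim=> [|a T [N BN]].
  exists 0%N => f _ sub_f; suff -> : f = 0 by [].
  apply/eqP; rewrite -msupp_eq0; case: (msupp f) sub_f => // b r /(_ b).
  by rewrite inE eqxx => /(_ isT).
(* A pivot [q] with nonzero coefficient at [a] removes [a] from the support of any [f]; without a
   pivot, every [f] is already supported in [T]. *)
case: (boolp.EM (exists q, [/\ K q, {subset msupp q <= a :: T} & q@_a != 0])).
  move=> [q [Kq sub_q qa0]]; have [M BM] := Bex q Kq.
  exists (maxn N M) => f Kf sub_f.
  pose c := f@_a / q@_a.
  rewrite -(subrK (c *: q) f); apply: BD; last first.
    by apply/BZ/(Bmono M) => //; rewrite leq_maxr.
  apply: (Bmono N); first by rewrite leq_maxl.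
  apply: BN; first by rewrite -scaleNr; apply/KD/KZ.
  move=> b; have [->|ne_ba] := eqVneq b a.
    by rewrite mcoeff_msupp mcoeffB mcoeffZ divfK // subrr eqxx.
  move/msuppB_le; rewrite mem_cat => /orP[/sub_f|/msuppZ_le /sub_q];
  by rewrite inE (negPf ne_ba).
move=> noq; exists N => f Kf sub_f; apply: BN => // b b_f.
have := sub_f b b_f; rewrite inE => /predU1P[eq_ba|//].
by case: noq; exists f; split=> //; rewrite -mcoeff_msupp -eq_ba.
Qed.

(** A single element of [I] is bounded by expanding it over [h] and using both signs of each
    generator; finite dimension in degree at most [d] makes the bound uniform. *)
Lemma ideal_qm_bounded (I : P -> Prop) (h p : seq P) :
  is_ideal I -> (forall f, I f <-> ideal_gen (fun q => q \in h) f) ->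
  {subset pm_seq h <= p} ->
  forall d, exists N, forall f, I f -> (tdeg f <= d)%N -> qm_bounded p N f.
Proof.
move=> hI Igen sub_h d; have [T inT] := mdeg_bounded_finite n d.
(* Bounded representations are stable only under nonnegative scalars; asking for both signs yields a
   vector space. *)
pose B N f := qm_bounded p N f /\ qm_bounded p N (- f).
have [|||||||N BN] := @uniform_bound_support I B _ _ _ _ _ _ _ T.
- exact: idealD.
- by move=> c f; rewrite -mul_mpolyC; apply: idealM.
- by move=> N f q [bf bNf] [bq bNq]; split; rewrite ?opprD; apply: qm_boundedD.
- move=> N c f [bf bNf]; have [c_ge0|/ltW c_le0] := leP 0 c.
    by split; rewrite -?scalerN; apply: qm_boundedZ.
  have Nc_ge0 : 0 <= - c by rewrite oppr_ge0.
  split; last by rewrite -scaleNr; apply: qm_boundedZ.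
  by rewrite -[c]opprK scaleNr -scalerN; apply: qm_boundedZ.
- by move=> N; split; rewrite ?oppr0; apply: qm_bounded0.
- by move=> N N' f leN [bf bNf]; split; apply: qm_bounded_mono leN _.
- move=> f /Igen[r gen_r ->]; elim: r gen_r => [|[a q] r IH] gen_r.
    by exists 0%N; rewrite big_nil; split; rewrite ?oppr0; apply: qm_bounded0.
  have [u ur|N [bN bNN]] := IH; first by apply: gen_r; rewrite inE ur orbT.
  have qh : q \in h by have := gen_r (a, q); rewrite inE eqxx => /(_ isT).
  have qp : q \in p by apply: sub_h; rewrite mem_pm_seq; apply/hasP; exists q; rewrite ?eqxx.
  have Nqp : - q \in p.
    by apply: sub_h; rewrite mem_pm_seq; apply/hasP; exists q; rewrite ?eqxx ?orbT.
  have [N1 b1] := qm_bounded_pm a qp Nqp.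
  have [N2 b2] := qm_bounded_pm (- a) qp Nqp.
  exists (maxn N (maxn N1 N2)); rewrite big_cons /B opprD -mulNr.
  by split; apply: qm_boundedD; [apply: qm_bounded_mono b1 | apply: qm_bounded_mono bN
    | apply: qm_bounded_mono b2 | apply: qm_bounded_mono bNN]; lia.
exists N => f If /tdeg_leP le_f; case: (BN f If) => // a a_f; exact/inT/le_f.
Qed.

End BoundedRepresentations.

(** * Stability from the weight bound *)

Theorem theorem3p3 (R : realType) (n s : nat) (g : 'I_s -> {mpoly R[n]})
    (I : {mpoly R[n]} -> Prop) (hI : is_ideal I)
    (hw : exists w : 'I_n -> R,
      [/\ forall i, 0 < w i,
          is_real_radical (init_ideal w I)
        & qm_basis (fun i => init_form w (g i)) (init_ideal w I)]) :
  qm_mod_stable g I.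
Proof.
case: hw => w [w_gt0 _ basis] h Igen.
set p := codom g ++ pm_seq h.
have sub_h : {subset pm_seq h <= p} by move=> q qh; rewrite mem_cat qh orbT.
have [C le_C] := weight_ge_mdeg w_gt0.
have [M le_M] := weight_le_mdeg w_gt0.
have [B hB] := boolp.choice (ideal_qm_bounded hI Igen sub_h).
(* For [f] of total degree [d], [M * d] bounds its weighted degree, and [C * (M * d)] the total
   degree of anything of no larger weight. The first argument of the maximum serves the squares, the
   second the remainder in [I]. *)
exists (fun d => maxn (C * (M * d)) (B (C * (M * d))))%N => f f0 QMf.
have [L [r [eq_f Ir redL]]] := QM_reduced hI Igen w_gt0 QMf.
have le_sq := reduced_wdeg_le hI basis eq_f Ir redL.
set d := tdeg f; have le_f : wdeg w f <= (M * d)%:R.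
  have [a a_f ->] := wdeg_mem w f0.
  apply: le_trans (le_M a) _; rewrite natrM ler_wpM2l // ler_nat.
  by apply: (proj1 (tdeg_leP d f)).
have tdeg_of_wle q : wle w (wdeg w f) q -> (tdeg q <= C * (M * d))%N.
  move=> le_q; apply/tdeg_leP => a /le_q le_a; rewrite -(ler_nat R).
  apply: le_trans (le_C a) _; rewrite natrM ler_wpM2l //.
  exact: le_trans le_f.
(* The remainder inherits the weight bound as the difference of [f] and the squares. *)
have rE : r = f - \sum_(u <- L) oapp g 1 u.1 * u.2 ^+ 2 by rewrite eq_f addrC addKr.
rewrite {1}eq_f; apply: qm_boundedD; last first.
  apply: qm_bounded_mono (leq_maxr _ _) _; apply: hB => //; apply: tdeg_of_wle.
  by rewrite rE; apply: wleD; [apply: wle_wdeg | apply/wleN/wle_sum].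
apply: qm_bounded_mono (leq_maxl _ _) _; apply: qm_bounded_sum => u uL.
have le_u := tdeg_of_wle _ (le_sq u uL); rewrite mulrC in le_u *.
apply: qm_bounded_gen => //; last exact: sosX2.
by case: (u.1) => [i|] /=; rewrite ?inE ?eqxx // mem_cat codom_f orbT.
Qed.
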